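(* Let $(H,X,V,\mathcal L,A,B,P,Q)$ be a strongly admissible tuple (defined in the context), and suppose that $A:V^X\to X$ is Fréchet differentiable. (This implies that for each fixed $z$ the functional $u\mapsto F(z,u)$, restricted to small $u\in X^\pm$ with the topology of $X$, is twice Fréchet differentiable.) Let $a_1,a_1',\rho_0$ and $F$ be as in the context, and let $s,r\in(0,\rho_0]$ satisfy $$B^\pm_{(r,s)}\subset B^\pm_{(\rho_0,\rho_0)}\quad\text{for}\quad r=s\sqrt{\frac{8a_1'}{a_1}}.$$ Then for the positive constants $$\varepsilon=a_1's^2,\qquad\hbar=\frac{a_1}{8}s^2$$ the following hold: (i) $(\nabla_2F(z,u),P^+u)_H\ge\hbar$ for all $(z,u)\in B^{(0)}_{\rho_0}\times B^\pm_{(r,s)}$ with $\|P^+u\|=s$; (ii) $(\nabla_2F(z,u),P^-u)_H\le-\hbar$ for all $(z,u)\in B^{(0)}_{\rho_0}\times B^\pm_{(r,s)}$ with $F(z,u)=-\varepsilon$; (iii) $F(z,u)\le-\varepsilon$ for all $(z,u)\in B^{(0)}_{\rho_0}\times B^\pm_{(r,s)}$ with $\|P^-u\|=r$. In particular, taking $z=\theta$: $(\nabla\mathcal L(u),P^+u)_H\ge\hbar$ for all $u\in B^\pm_{(r,s)}$ with $\|P^+u\|=s$; $(\nabla\mathcal L(u),P^-u)_H\le-\hbar$ for all $u\in B^\pm_{(r,s)}$ with $\mathcal L(u)=-\varepsilon$; and $\mathcal L(u)\le-\varepsilon$ for all $u\in B^\pm_{(r,s)}$ with $\|P^-u\|=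r$.
   Context: Conventions. All vector spaces are real; $\theta$ denotes the origin of any of them. $B_E(\theta,r)$ is the open ball of a normed space $E$. $L_s(H)\subset L(H)$ is the space of bounded self-adjoint operators. A map $T:U\to E_2$ on an open subset $U$ of a normed space $E_1$ is continuously directional differentiable on $U$ if $DT(x,u)=\lim_{t\to0}(T(x+tu)-T(x))/t$ exists for all $x\in U$, $u\in E_1$ and $(x,u)\mapsto DT(x,u)$ is continuous on $U\times E_1$ (then $DT(x):=DT(x,\cdot)$ is bounded linear). $T$ is strictly Fréchet differentiable at $x_0$ if there is $T'(x_0)\in L(E_1,E_2)$ with $\|T(x)-T(y)-T'(x_0)(x-y)\|=o(\|x-y\|)$ as $x\to x_0$, $y\to x_0$. A critical point is a point where the (Gâteaux) derivative vanishes. $\nabla\mathcal L(x)\in H$ is defined by $(\nabla\mathcal L(x),u)_H=D\mathcal L(x)(u)$. Strongly admissible tuple. $(H,X,V,\mathcal L,A,B,P,Q)$ is strongly admissible if: (S) $H$ is a Hilbert space with inner product $(\cdot,\cdot)_H$ and norm $\|\cdot\|$; $X$ is a Banach space with norm $\|\cdot\|_X$; $X\subset H$ is a dense linear subspace and $\|x\|\le\|x\|_X$ for $x\in X$. $V$ is an open neighborhood of $\theta$ in $H$; $V^X:=V\cap X$ regarded as an open subset of $X$. (F1) $\mathcal L:V\to\mathbb R$ is continuously directional differentiable on $V$. (F2) $A:V^X\to X$ is continuously directional differentiable, strictly Fréchet differentiable at $\theta$, and $D\mathcal L(x)(u)=(A(x),u)_H$ for all $x\in V^X$, $u\in X$.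 (F3) $B:V^X\to L_s(H)$ is a map with $(DA(x)(u),v)_H=(B(x)u,v)_H$ for all $x\in V^X$, $u,v\in X$. (C1) $\theta$ is a critical point of $\mathcal L|_{V^X}$ (and thus of $\mathcal L$), and $0$ is either not in the spectrum $\sigma(B(\theta))$ or is an isolated point of it. (C2) If $u\in H$ and $B(\theta)u\in X$, then $u\in X$. (D) $B(x)=P(x)+Q(x)$ for all $x\in V^X$, where $P(x):H\to H$ is a positive definite linear operator and $Q(x):H\to H$ is a compact linear operator, with: (D1) all eigenvectors of $B(\theta)$ belonging to negative eigenvalues lie in $X$; (D2) for any sequence $\{x_k\}\subset V\cap X$ with $\|x_k\|\to0$, $\|P(x_k)u-P(\theta)u\|\to0$ for every $u\in H$; (D3) $Q:V\cap X\to L(H)$ is continuous at $\theta$ with respect to the topology on $V\cap X$ induced from $H$; (D4** ) there exist positive constants $\eta_0'$ and $C_2'>C_1'$ such that $C_2'\|u\|^2\ge(P(x)u,u)_H\ge C_1'\|u\|^2$ for all $u\in H$, $x\in B_H(\theta,\eta_0')\cap X$. Notation. $H^0=\mathrm{Ker}(B(\theta))$, $H^\pm=(H^0)^\perp$, and $H=H^0\oplus H^+\oplus H^-$ orthogonally, with $H^+$, $H^-$ invariant under $B(\theta)$ and $B(\theta)$ positive definite on $H^+$, negative definite on $H^-$. $H^0$ and $H^-$ are finite dimensional and contained in $X$. $P^0,P^+,P^-$ are the orthogonal projections onto $H^0,H^+,H^-$; $X^\pm=X\cap H^\pm$. $a_0>0$ is such that $[-2a_0,2a_0]\cap\sigma(B(\theta))\subset\{0\}$.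 Near $\theta\in H^0$, $h$ is the unique Lipschitz continuous $X^\pm$-valued map with $h(\theta)=\theta$ and $(I-P^0)A(z+h(z))=\theta$. $F(z,u)=\mathcal L(z+h(z)+u)-\mathcal L(z+h(z))$ for small $z\in H^0$, $u\in H^\pm$, and $\nabla_2F(z,u)\in H^\pm$ is the gradient in $u$. $\omega:V\cap X\to[0,\infty)$ is a fixed function with $\omega(x)\to0$ as $\|x\|\to0$ and $|(B(x)u,v)_H-(B(\theta)u,v)_H|\le\omega(x)\|u\|\|v\|$ for $x\in V\cap X$, $u\in H^0\oplus H^-$, $v\in H$. $U\subset V$ is a fixed small neighborhood of $\theta$ in $H$ and $a_1\in(0,a_0]$ a fixed number such that for all $x\in U\cap X$: $(B(x)u,u)_H\ge a_1\|u\|^2$ for $u\in H^+$; $|(B(x)u,v)_H|\le\omega(x)\|u\|\|v\|$ for $u\in H^+$, $v\in H^-\oplus H^0$; $(B(x)u,u)_H\le-a_0\|u\|^2$ for $u\in H^-$. (Such $\omega,U,a_1$ exist.) $B^{( * )}_\rho=\{v\in H^*:\|v\|\le\rho\}$ for $*=+,0,-$, and $B^\pm_{(r,s)}=B^{(-)}_r\oplus B^{(+)}_s$. $$a_1'=\frac{2C_2'+\|Q(\theta)\|+1}{2}+\frac1{3a_1}.$$ A small $\rho\in(0,\eta_0')$ is fixed so that $B^{(0)}_\rho\oplus B^{(-)}_\rho\oplus B^{(+)}_\rho\subset U$. Then $\rho_0\in(0,\rho]$ is chosen so small (with $F$ defined on $B^{(0)}_{\rho_0}\times B^\pm_{(\rho_0,\rho_0)}$)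 that for all $z\in B^{(0)}_{\rho_0}$ and $u\in B^\pm_{(\rho_0,\rho_0)}\cap X$: $\|Q(z+h(z)+u)-Q(\theta)\|\le C_1'/2$, $\omega(z+h(z)+u)<\sqrt{a_1/2}$ and $\omega(z+h(z)+u)\le a_1/(8a_1')$.
   Formalization: The two final assertions involving the value L(u) are stated under the normalization L(θ)=0 (they fail for L plus a constant); the choice of ρ₀ explicitly includes that z+h(z)+u lies in U and in B_H(θ,η₀′); the parenthetical remark on twice differentiability of F is not stated. *)

(* Defs.v *)
From HB Require Import structures.
From mathcomp Require Import all_boot all_order all_algebra sesquilinear.
From mathcomp Require Import all_classical all_reals all_analysis.

Set Implicit Arguments.
Unset Strict Implicit.
Unset Printing Implicit Defensive.

Import Order.TTheory GRing.Theory Num.Theory.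
Import numFieldNormedType.Exports.

Local Open Scope classical_set_scope.
Local Open Scope ring_scope.

Section Calculus.
Context {R : realType} {E1 E2 : normedModType R}.
Implicit Types (T : E1 -> E2) (U : set E1).

(* Maps defined on an open set [U] are represented by total functions, about
   which nothing is assumed outside [U]; the derivatives below only depend on
   the values near the point. *)
Definition cont_dir_differentiable U T :=
  (forall x u, U x -> derivable T x u) /\
  {within U `*` setT, continuous (fun p : E1 * E1 => 'D_(p.2) T p.1)}.

Definition strictly_differentiable T (x0 : E1) :=
  exists T' : {linear E1 -> E2}, continuous T' /\
    forall e : R, 0 < e -> \forall x \near x0 & y \near x0,
      `|T x - T y - T' (x - y)| <= e * `|x - y|.

Definition critical_point T (x : E1) := forall u, is_derive x u T 0.

End Calculus.

Section Sets.
Context {R : realType} {H : completeNormedModType R}.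
Implicit Types (W Z : set H).

Definition linear_subspace W :=
  W 0 /\ forall (a : R) u v, W u -> W v -> W (a *: u + v).

Definition finite_dimensional W :=
  exists n (e : 'I_n -> H), forall u, W u ->
    exists c : 'I_n -> R, u = \sum_(j < n) c j *: e j.

Definition cball W (r : R) : set H := [set v | W v /\ `|v| <= r].

Definition set_sum W Z : set H := [set u + v | u in W & v in Z].

End Sets.

Section Operators.
Context {R : realType} {H : completeNormedModType R} (dot : {dot H for idfun}).
Implicit Types (T S : {linear H -> H}) (W : set H).

Definition opker T : set H := [set u | T u = 0].

Definition bounded_selfadjoint T :=
  continuous T /\ forall u v, dot (T u) v = dot u (T v).

Definition opnorm (f : H -> H) : R := sup [set `|f u| | u in cball setT 1].

Definition compact_operator T := precompact (T @` cball setT 1).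

Definition spectrum T : set R :=
  [set l | ~ exists S, continuous S /\
     forall u, S (T u - l *: u) = u /\ T (S u) - l *: S u = u].

Definition pos_def_on W T := forall u, W u -> u != 0 -> 0 < dot (T u) u.
Definition neg_def_on W T := forall u, W u -> u != 0 -> dot (T u) u < 0.

Definition orthc W : set H := [set u | forall w, W w -> dot u w = 0].

(* The orthogonal projection onto [W]; it is unique whenever it exists. *)
Definition orth_proj W (u : H) : H :=
  xget 0 [set v | W v /\ orthc W (u - v)].

(* The gradient at [u] of the restriction of [f] to the subspace [W], namely
   the vector of [W] representing its directional derivative (unique when it
   exists). *)
Definition grad W (f : H -> R) (u : H) : H :=
  xget 0 [set g | W g /\ forall v, W v -> is_derive u v f (dot g v)].

End Operators.

Section Setting.
Context {R : realType} {H X : completeNormedModType R}.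
(* [iota] is the inclusion of [X] in [H]: the elements of the intersection of
   [V] and [X] are the [x : X] such that [V (iota x)]. *)
Variables (dot : {dot H for idfun}) (iota : {linear X -> H}).
Variables (V : set H) (L : H -> R) (A : X -> X) (B P Q : X -> {linear H -> H}).

Let inX : set H := range iota.
Let VX : set X := iota @^-1` V.

Definition form_bounds (eta0 C1 C2 : R) :=
  [/\ 0 < eta0, 0 < C1, C1 < C2 &
    forall x u, VX x -> `|iota x| < eta0 ->
      C1 * `|u| ^+ 2 <= dot (P x u) u <= C2 * `|u| ^+ 2].

Record strongly_admissible : Prop := StronglyAdmissible {
  sa_hilbert : forall u, dot u u = `|u| ^+ 2 ;
  sa_inj : injective iota ;
  sa_norm : forall x, `|iota x| <= `|x| ;
  sa_dense : dense inX ;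
  sa_open : open V ;
  sa_0 : V 0 ;
  sa_F1 : cont_dir_differentiable V L ;
  sa_F2_cdd : cont_dir_differentiable VX A ;
  sa_F2_strict : strictly_differentiable A 0 ;
  sa_F2_grad : forall x u, VX x ->
    'D_(iota u) L (iota x) = dot (iota (A x)) (iota u) ;
  sa_F3_sa : forall x, VX x -> bounded_selfadjoint dot (B x) ;
  sa_F3_hess : forall x u v, VX x ->
    dot (iota ('D_u A x)) (iota v) = dot (B x (iota u)) (iota v) ;
  sa_C1_crit : critical_point (L \o iota) 0 ;
  sa_C1_spec : ~ spectrum (B 0) 0 \/ isolated (spectrum (B 0)) 0 ;
  sa_C2 : forall u, inX (B 0 u) -> inX u ;
  sa_D : forall x u, VX x -> B x u = P x u + Q x u ;
  sa_D_pos : forall x, VX x -> pos_def_on dot setT (P x) ;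
  sa_D_compact : forall x, VX x -> compact_operator (Q x) ;
  sa_D1 : forall (l : R) v, l < 0 -> v != 0 -> B 0 v = l *: v -> inX v ;
  sa_D2 : forall x_ : nat -> X, (forall k, VX (x_ k)) ->
    `|iota (x_ k)| @[k --> \oo] --> (0 : R) ->
    forall u, `|P (x_ k) u - P 0 u| @[k --> \oo] --> (0 : R) ;
  (* the neighborhoods of 0 are those of the norm of [H], not of [X] *)
  sa_D3 : forall e : R, 0 < e -> exists2 d : R, 0 < d &
    forall x, VX x -> `|iota x| < d -> opnorm (Q x \- Q 0) < e ;
  sa_D4 : exists eta0 C1 C2, form_bounds eta0 C1 C2
}.

Variables Hp Hm : set H.
Let H0 : set H := opker (B 0).
Let Hpm : set H := orthc dot H0.

Record spectral_splitting : Prop := SpectralSplitting {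
  ss_subp : linear_subspace Hp ;
  ss_subm : linear_subspace Hm ;
  ss_orthp : Hp `<=` orthc dot H0 ;
  ss_orthm : Hm `<=` orthc dot H0 ;
  ss_orthpm : Hp `<=` orthc dot Hm ;
  ss_sum : set_sum (set_sum H0 Hp) Hm = setT ;
  ss_invp : forall u, Hp u -> Hp (B 0 u) ;
  ss_invm : forall u, Hm u -> Hm (B 0 u) ;
  ss_pos : pos_def_on dot Hp (B 0) ;
  ss_neg : neg_def_on dot Hm (B 0) ;
  ss_fin0 : finite_dimensional H0 ;
  ss_finm : finite_dimensional Hm ;
  ss_0X : H0 `<=` inX ;
  ss_mX : Hm `<=` inX
}.

Definition spectral_gap (a0 : R) :=
  0 < a0 /\ `[- (2 * a0), 2 * a0]%classic `&` spectrum (B 0) `<=` [set 0].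

(* [h] on the closed ball of radius [d] of the kernel. In [rm_eq] the point [z]
   of the kernel is [iota y]. *)
Record reduction_map (h : H -> X) (d : R) : Prop := ReductionMap {
  rm_d : 0 < d ;
  rm_0 : h 0 = 0 ;
  rm_lip : [lipschitz h z | z in cball H0 d] ;
  rm_V : forall z, cball H0 d z -> V (z + iota (h z)) ;
  rm_pm : forall z, cball H0 d z -> Hpm (iota (h z)) ;
  rm_eq : forall y, cball H0 d (iota y) ->
    let a := iota (A (y + h (iota y))) in a - orth_proj dot H0 a = 0
}.

Record modulus (omega : X -> R) : Prop := Modulus {
  mod_ge0 : forall x, VX x -> 0 <= omega x ;
  mod_cvg0 : forall e : R, 0 < e -> exists2 d : R, 0 < d &
    forall x, VX x -> `|iota x| < d -> omega x < e ;
  mod_bound : forall x u v, VX x -> set_sum H0 Hm u ->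
    `|dot (B x u) v - dot (B 0 u) v| <= omega x * `|u| * `|v|
}.

Record local_estimates (omega : X -> R) (a0 a1 : R) (U : set H) : Prop :=
  LocalEstimates {
  est_nbhs : nbhs 0 U ;
  est_V : U `<=` V ;
  est_a1 : 0 < a1 <= a0 ;
  est_pos : forall x u, U (iota x) -> Hp u ->
    a1 * `|u| ^+ 2 <= dot (B x u) u ;
  est_mix : forall x u v, U (iota x) -> Hp u -> set_sum Hm H0 v ->
    `|dot (B x u) v| <= omega x * `|u| * `|v| ;
  est_neg : forall x u, U (iota x) -> Hm u ->
    dot (B x u) u <= - a0 * `|u| ^+ 2
}.

Definition box (r s : R) : set H := set_sum (cball Hm r) (cball Hp s).

Definition reducedF (h : H -> X) (z u : H) : R :=
  L (z + iota (h z) + u) - L (z + iota (h z)).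

Definition a1_prime (C2 a1 : R) : R :=
  (2 * C2 + opnorm (Q 0) + 1) / 2 + (3 * a1)^-1.

Definition small_rho (eta0 : R) (U : set H) (rho : R) :=
  0 < rho < eta0 /\
  set_sum (set_sum (cball H0 rho) (cball Hm rho)) (cball Hp rho) `<=` U.

(* [s0_dom]: "so small that F is defined" includes that the points
   [z + h z + u] stay in the neighborhoods on which the estimates hold. *)
Record small_rho0 (eta0 C1 C2 a1 : R) (U : set H) (omega : X -> R)
    (h : H -> X) (d rho rho0 : R) : Prop := SmallRho0 {
  s0_pos : 0 < rho0 <= rho ;
  s0_d : rho0 <= d ;
  s0_dom : forall z u, cball H0 rho0 z -> box rho0 rho0 u ->
    U (z + iota (h z) + u) /\ `|z + iota (h z) + u| < eta0 ;
  (* [x : X] is the point [z + h z + u]; as [z] lies in [X], it exists if and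
     only if [u] lies in [X] *)
  s0_bounds : forall z u x, cball H0 rho0 z -> box rho0 rho0 u ->
    iota x = z + iota (h z) + u ->
    [/\ opnorm (Q x \- Q 0) <= C1 / 2,
        omega x < Num.sqrt (a1 / 2) &
        omega x <= a1 / (8 * a1_prime C2 a1)]
}.

End Setting.

(* Main.v *)
(* Put x = z + h(z) and u = m + p with m in H^-, p in H^+. As A(x) lies in H^0,
   the mean value theorem and a second-order Taylor formula along the segment
   t |-> x + t u express D L(x + u) on H^+ + H^- and F(z, u) through the form
   (B(x + t u)u, .), whose blocks are controlled by a1, a0, omega and the
   splitting B = P + Q. This needs u in X; since X is dense in H and D L is
   continuous, the resulting bounds extend to every p in H^+. The three
   assertions then follow from the choice of a1' and r. As L is differentiable
   only directionally and A is defined only on X, the gradient at a point of H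
   is obtained from the Riesz representation theorem. *)

Require Import Defs.
From HB Require Import structures.
From mathcomp Require Import all_boot all_order all_algebra sesquilinear.
From mathcomp Require Import all_classical all_reals all_analysis.
From mathcomp Require Import ring lra.

Set Implicit Arguments.
Unset Strict Implicit.
Unset Printing Implicit Defensive.

Import Order.TTheory GRing.Theory Num.Theory.
Import numFieldNormedType.Exports.

Local Open Scope classical_set_scope.
Local Open Scope ring_scope.

(** * Inner products: Cauchy-Schwarz and Riesz representation *)

Section InnerProduct.
Context {R : realType} {H : completeNormedModType R} (dot : {dot H for idfun}).
Implicit Types (u v w : H) (a : R).

Lemma dotC u v : dot u v = dot v u.
Proof. by rewrite hermC /= expr0 mul1r. Qed.

Lemma dotDl u v w : dot (u + v) w = dot u w + dot v w.
Proof. by rewrite linearDl. Qed.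

Lemma dotZl a u v : dot (a *: u) v = a * dot u v.
Proof. by rewrite linearZl_LR. Qed.

Lemma dotDr u v w : dot u (v + w) = dot u v + dot u w.
Proof. by rewrite linearDr. Qed.

Lemma dotZr a u v : dot u (a *: v) = a * dot u v.
Proof. by rewrite linearZr_LR. Qed.

Lemma dot0l u : dot 0 u = 0.
Proof. by rewrite -(scale0r 0) dotZl mul0r. Qed.

Hypothesis dot_norm : forall u, dot u u = `|u| ^+ 2.

Lemma sqr_normD u v : `|u + v| ^+ 2 = `|u| ^+ 2 + 2 * dot u v + `|v| ^+ 2.
Proof. by rewrite -!dot_norm !dotDl !dotDr (dotC v u); ring. Qed.

Lemma dot_CauchySchwarz u v : `|dot u v| <= `|u| * `|v|.
Proof.
have [->|v0] := eqVneq v 0.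
  by rewrite dotC dot0l !normr0 mulr0.
have v2 : 0 < `|v| ^+ 2 by rewrite exprn_gt0 // normr_gt0.
rewrite -(ler_pXn2r (_ : (0 < 2)%N)) ?nnegrE ?mulr_ge0 // exprMn real_normK ?num_real //.
(* Up to the factor [|v|^2] this is the component of [u] orthogonal to [v]. *)
have : 0 <= `| `|v| ^+ 2 *: u + (- dot u v) *: v| ^+ 2 by [].
rewrite sqr_normD dotZl dotZr !normrZ normrN !exprMn real_normK ?num_real //.
rewrite [`|dot u v| ^+ 2]real_normK ?num_real // => h.
have : 0 <= `|v| ^+ 2 * (`|u| ^+ 2 * `|v| ^+ 2 - dot u v ^+ 2).
  by apply: le_trans h _; rewrite le_eqVlt; apply/orP; left; apply/eqP; ring.
by rewrite pmulr_rge0 // subr_ge0.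
Qed.

Lemma quadratic_ge0_lin0 (b c : R) :
  (forall t, 0 <= c * t ^+ 2 + b * t) -> b = 0.
Proof.
move=> h; have c0 : 0 <= c by have := h 1; have := h (-1); lra.
(* At this point the polynomial equals [- k ^+ 2], which forces [k = 0]; the shift by 1 keeps the
   denominator positive when [c = 0]. *)
have := h (- b / (c + 1)); set k := _ / _ => hk.
have kE : k * (c + 1) = - b by rewrite /k divfK // gt_eqF // ltr_wpDl.
have k2 : 0 <= - k ^+ 2.
  have -> : - k ^+ 2 = c * k ^+ 2 + b * k by rewrite -[b]opprK -kE; ring.
  exact: hk.
have /eqP : k ^+ 2 = 0 by have := sqr_ge0 k; lra.
by rewrite sqrf_eq0 => /eqP k0; move: kE; rewrite k0 mul0r; lra.
Qed.

(* The representative is the minimizer of [|v|^2 / 2 - f v]; minimizing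
   sequences are Cauchy by the parallelogram identity. *)
Lemma riesz_representation (f : H -> R) (C : R) :
    (forall a u v, f (a *: u + v) = a * f u + f v) ->
    (forall v, `|f v| <= C * `|v|) ->
  exists g, forall v, f v = dot g v.
Proof.
move=> flin fC.
have fZ a u : f (a *: u) = a * f u.
  have f0 : f 0 = 0 by have := flin 1 0 0; rewrite scale1r addr0; lra.
  by rewrite -[a *: u]addr0 flin f0 addr0.
have fD u v : f (u + v) = f u + f v by rewrite -{1}[u]scale1r flin mul1r.
have fB u v : f (u - v) = f u - f v by rewrite fD -scaleN1r fZ mulN1r.
pose J v := `|v| ^+ 2 / 2 - f v.
have JC v : - (C ^+ 2 / 2) <= J v.
  have := fC v; rewrite ler_norml /J => /andP[_ fv].
  have := sqr_ge0 (`|v| - C); lra.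
have hinf : has_inf (range J).
  split; first by exists (J 0), 0.
  by exists (- (C ^+ 2 / 2)) => _ [v _ <-].
set mu := inf (range J).
have muJ v : mu <= J v by apply: ge_inf; [case: hinf | exists v].
have exv (n : nat) : exists v, J v < mu + n.+1%:R^-1.
  have n0 : 0 < n.+1%:R^-1 :> R by rewrite invr_gt0.
  by have [_ [v _ <-] ?] := inf_adherent n0 hinf; exists v.
have [v_ Jv] := choice exv.
(* The linear terms of [J] cancel, so the distance of two points is controlled by the excess of [J]
   over [mu]. *)
have Jpar u v : `|u - v| ^+ 2 = 4 * (J u + J v - 2 * J (2^-1 *: (u + v))).
  rewrite /J normrZ fZ exprMn fD !sqr_normD -!dot_norm.
  rewrite -scaleN1r !dotZr dotZl gtr0_norm ?invr_gt0//. by field. 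
have vcauchy : cauchy (v_ @ \oo).
  apply/cauchy_ballP => e e0.
  (* Two excesses below [e ^+ 2 / 8], multiplied by the factor 4 of [Jpar], stay below [e ^+ 2]. *)
  have e4 : 0 < e ^+ 2 / 8 by rewrite divr_gt0 ?exprn_gt0.
  have [N _ hN] : \forall n \near \oo, n.+1%:R^-1 < e ^+ 2 / 8.
    exact: near_infty_natSinv_lt (PosNum e4).
  exists (v_ @` [set n | (N <= n)%N], v_ @` [set n | (N <= n)%N]).
    by split; exists N => // n Nn; exists n.
  move=> _ [[n Nn <-] [k Nk <-]]; rewrite -ball_normE /=.
  rewrite -(ltr_pXn2r (_ : (0 < 2)%N)) ?nnegrE ?(ltW e0)// Jpar.
  have := muJ (2^-1 *: (v_ n + v_ k)).
  have := Jv n; have := Jv k; have := hN n Nn; have := hN k Nk => /=.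
  move: (n.+1%:R^-1 : R) (k.+1%:R^-1 : R) (J _) (J _) (J _) => *; lra.
have /cvg_ex[g vg] : cvg (v_ @ \oo) by apply/cauchy_cvgP.
have Jg : J g <= mu.
  have Jvg : J (v_ n) @[n --> \oo] --> J g.
    apply: cvgB.
      apply: cvgMr_tmp; rewrite expr2; under eq_fun do rewrite expr2.
      by apply: cvgM; apply: cvg_norm.
    apply/cvgrPdist_le => e e0; near=> n.
    have C1 : 0 < `|C| + 1 by rewrite ltr_wpDl.
    rewrite -fB; apply: le_trans (fC _) _.
    apply: (@le_trans _ _ ((`|C| + 1) * `|g - v_ n|)).
      by rewrite ler_wpM2r// ler_wpDr// ler_norm.
    rewrite -ler_pdivlMl//; near: n.
    by move/cvgrPdist_le : vg; apply; rewrite mulr_gt0// invr_gt0.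
  apply: ler_cvg_to Jvg _ _.
    rewrite -[mu]addr0; apply: cvgD; first exact: cvg_cst.
    exact: cvg_harmonic.
  by apply: nearW => n; apply/ltW/Jv.
(* First-order condition at the minimizer: [J (g + t *: v) - J g] is a nonnegative quadratic in [t]
   with linear coefficient [dot g v - f v]. *)
exists g => v; apply/eqP; rewrite -subr_eq0; apply/eqP.
rewrite -(opprK (f v - _)) opprB.
rewrite (@quadratic_ge0_lin0 (dot g v - f v) (`|v| ^+ 2 / 2)) ?oppr0// => t.
have := le_trans Jg (muJ (g + t *: v)).
rewrite /J fD fZ sqr_normD dotZr normrZ exprMn real_normK ?num_real//; lra.
Unshelve. all: by end_near. Qed.

End InnerProduct.

(** * Directional derivatives along lines, under translations and under linear functionals *)

Section Calculus.
Context {R : realType} {E F : normedModType R}.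
Implicit Types (T : E -> F) (x u v : E).

(** Both difference quotients are the same function, so the rule holds for merely directional
    derivatives. *)
Lemma is_derive_line T x u (t : R) (df : F) :
  is_derive (x + t *: u) u T df -> is_derive t 1 (fun t => T (x + t *: u)) df.
Proof.
have qE : (fun h : R => h^-1 *: (((fun t => T (x + t *: u)) \o shift t) h%:A
             - T (x + t *: u))) =
          (fun h : R => h^-1 *: ((T \o shift (x + t *: u)) (h *: u)
             - T (x + t *: u))).
  apply/funext => h /=.
  by rewrite [h%:A]mulr1 scalerDl addrCA.
by move=> [Td <-]; split; rewrite /derivable /derive qE.
Qed.

Lemma is_derive_translate T x u v (c df : F) :
  is_derive (x + u) v T df -> is_derive u v (fun u => T (x + u) - c) df.
Proof.
have qE : (fun h : R => h^-1 *: (((fun u => T (x + u) - c) \o shift u) (h *: v)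
             - (T (x + u) - c))) =
          (fun h : R => h^-1 *: ((T \o shift (x + u)) (h *: v) - T (x + u))).
  by apply/funext => h /=; rewrite opprB addrA subrK addrCA.
by move=> [Td <-]; split; rewrite /derivable /derive qE.
Qed.

(** A bounded linear functional commutes with the limit of the difference quotients. The proof works
    with [|C| + 1], which is positive whatever the sign of [C]. *)
Lemma is_derive_scalar_comp (l : F -> R) (C : R) T x u (df : F) :
    (forall a y z, l (a *: y + z) = a * l y + l z) ->
    (forall y, `|l y| <= C * `|y|) ->
  is_derive x u T df -> is_derive x u (l \o T) (l df).
Proof.
move=> llin lC [Td <-].
have l0 : l 0 = 0 by have := llin 1 0 0; rewrite scale1r addr0; lra.
have lZ a y : l (a *: y) = a * l y by rewrite -[a *: y]addr0 llin l0 addr0.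
have lB y z : l (y - z) = l y - l z.
  by rewrite addrC -scaleN1r llin mulN1r addrC.
have qcvg : (fun h : R => h^-1 *: (((l \o T) \o shift x) (h *: u) - (l \o T) x))
    @ 0^' --> l ('D_u T x).
  apply/cvgrPdist_le => e e0.
  have C1 : 0 < `|C| + 1 by rewrite ltr_wpDl.
  move/cvgrPdist_le : Td => /(_ (e / (`|C| + 1))).
  rewrite divr_gt0// => /(_ isT); apply: filterS => h /= Th.
  rewrite -lB -[_ *: l _]lZ -lB (le_trans (lC _))//.
  apply: (@le_trans _ _ ((`|C| + 1) * (e / (`|C| + 1)))).
    apply: (@le_trans _ _ ((`|C| + 1) * `|'D_u T x - h^-1 *: (T (h *: u + x) - T x)|)).
      by rewrite ler_wpM2r// ler_wpDr// ler_norm.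
    by rewrite ler_wpM2l// ltW.
  by rewrite mulrCA divff ?mulr1// gt_eqF.
split; first by apply/cvg_ex; exists (l ('D_u T x)).
exact/cvg_lim.
Qed.

End Calculus.

(** * Mean value and second-order Taylor inequalities on an interval *)

Section OneVariable.
Context {R : realType}.
Implicit Types f df : R -> R.

Lemma mean_value f df (t : R) : 0 <= t ->
    (forall x, 0 <= x <= t -> is_derive x 1 f (df x)) ->
  exists2 c, 0 <= c <= t & f t - f 0 = df c * t.
Proof.
move=> t0 fdf.
have [||c /[!in_itv]/= ct fE] := @MVT_segment _ f df 0 t t0.
- by move=> x /[!in_itv]/= /andP[? ?]; apply: fdf; rewrite !ltW.
- apply: derivable_within_continuous => x /[!in_itv]/= xt.
  by have := fdf x xt => -[].
- by exists c => //; rewrite fE subr0.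
Qed.

(** The mean value theorem is applied twice: to [f1], giving [k * t <= f1 t], then to
    [f t - k / 2 * t ^+ 2], whose derivative is therefore nonnegative. The second derivative [f2] is
    only required pointwise. *)
Lemma second_order_ge f (f1 f2 : R -> R) (k : R) :
    (forall t : R, 0 <= t <= 1 -> is_derive t 1 f (f1 t)) ->
    (forall t : R, 0 <= t <= 1 -> is_derive t 1 f1 (f2 t)) ->
    f1 0 = 0 -> (forall t : R, 0 <= t <= 1 -> k <= f2 t) ->
  k / 2 <= f 1 - f 0.
Proof.
move=> ff1 f1f2 f10 kf2.
have f1k (t : R) : 0 <= t <= 1 -> k * t <= f1 t.
  move=> /andP[t0 t1].
  have [|c /andP[c0 ct]] := @mean_value f1 f2 t t0.
    move=> x /andP[x0 xt]; apply: f1f2; rewrite x0; exact: le_trans t1.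
  rewrite f10 subr0 => ->; rewrite ler_wpM2r//; apply: kf2.
  by rewrite c0 (le_trans ct).
have gd (t : R) : 0 <= t <= 1 ->
    is_derive t 1 (fun t => f t - k / 2 * t ^+ 2) (f1 t - k * t).
  move=> t01; have ? := ff1 t t01.
  have -> : (fun t => f t - k / 2 * t ^+ 2) = f - (k / 2) *: (id ^+ 2).
    by apply/funext => y; rewrite !fctE.
  apply: is_derive_eq.
  rewrite /GRing.scale /=; by field.
have [c /andP[c0 c1]] := mean_value ler01 gd.
rewrite mulr1 expr1n expr0n /= mulr0 subr0 mulr1 => e.
have := f1k c; rewrite c0 c1 => /(_ isT); lra.
Qed.

Lemma second_order_le f (f1 f2 : R -> R) (k : R) :
    (forall t : R, 0 <= t <= 1 -> is_derive t 1 f (f1 t)) ->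
    (forall t : R, 0 <= t <= 1 -> is_derive t 1 f1 (f2 t)) ->
    f1 0 = 0 -> (forall t : R, 0 <= t <= 1 -> f2 t <= k) ->
  f 1 - f 0 <= k / 2.
Proof.
move=> ff1 f1f2 f10 kf2.
have := @second_order_ge (- f) (- f1) (- f2) (- k).
rewrite !fctE => h; suff : - k / 2 <= - f 1 - - f 0 by lra.
apply: h => //= [t t01|t t01||t t01].
- by have ? := ff1 t t01; apply: is_deriveN.
- by have ? := f1f2 t t01; apply: is_deriveN.
- by rewrite f10 oppr0.
- by rewrite lerN2 kf2.
Qed.

End OneVariable.

(** * Maps whose directional derivative is jointly continuous *)

Section ContinuousDirectionalDerivative.
Context {R : realType} {E F : normedModType R} (U : set E) (T : E -> F).
Hypotheses (oU : open U) (dT : cont_dir_differentiable U T).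

Lemma cont_dir_derive x v : U x ->
  {for (x, v), continuous (fun p : E * E => 'D_(p.2) T p.1)}.
Proof.
move=> Ux; case: dT => _; rewrite continuous_open_subspace.
  by apply; rewrite inE.
rewrite openE => -[y w] [/= Uy _].
exists (U, setT); last by move=> z [].
by split => //=; [exact: open_nbhs_nbhs | exact: filterT].
Qed.

Lemma cvg_dir_derive (x_ v_ : nat -> E) x v : U x ->
    x_ n @[n --> \oo] --> x -> v_ n @[n --> \oo] --> v ->
  'D_(v_ n) T (x_ n) @[n --> \oo] --> 'D_v T x.
Proof.
move=> Ux xx vv.
have := @cvg_comp _ _ _ (fun n => (x_ n, v_ n)) (fun p : E * E => 'D_(p.2) T p.1)
   \oo (nbhs (x, v)) (nbhs ('D_v T x)).
apply; last exact: cont_dir_derive.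
exact: cvg_pair.
Qed.

End ContinuousDirectionalDerivative.

(** The derivative in direction 0 vanishes, so by joint continuity at [(x, 0)] it is small for base
    points near [x] and short directions. The mean value theorem on the segment from [x] to [y],
    with direction [y - x], then bounds the increment. *)
Lemma cont_dir_differentiable_continuous {R : realType} {E : normedModType R}
    (U : set E) (T : E -> R) : open U -> cont_dir_differentiable U T ->
  forall x, U x -> {for x, continuous T}.
Proof.
move=> oU dT x Ux; apply/cvgrPdist_le => e e0.
have := cont_dir_derive oU dT (v := 0) Ux.
move/cvgrPdist_lt => /(_ e e0) [[A B]] /= [xA B0] AB.
have : nbhs x (U `&` A) by apply: filterI => //; exact: open_nbhs_nbhs.
case/nbhs_ballP => d1 /= d10 d1A.
case/nbhs_ballP: B0 => d2 /= d20 d2B.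
apply/nbhs_ballP; exists (Num.min d1 d2) => /=; first by rewrite lt_min d10.
move=> y; rewrite -ball_normE /= lt_min => /andP[xy1 xy2].
have inb (t : R) : 0 <= t <= 1 -> (U `&` A) (x + t *: (y - x)).
  move=> /andP[t0 t1]; apply: d1A; rewrite -ball_normE /= opprD addrA subrr sub0r.
  rewrite normrN normrZ ger0_norm// distrC; apply: le_lt_trans xy1.
  by rewrite ler_piMl.
have [|c c01] := @mean_value _ (fun t : R => T (x + t *: (y - x)))
    (fun t => 'D_(y - x) T (x + t *: (y - x))) 1 ler01.
  move=> t /inb[Ut _]; apply: is_derive_line; apply: derivableP.
  by case: dT => + _; apply.
rewrite scale1r scale0r addr0 mulr1 subrKC => Te.
rewrite distrC Te; have [Uc Ac] := inb c c01.
have /= := AB (x + c *: (y - x), y - x); rewrite derive0 sub0r normrN => h.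
apply/ltW/h; split => //=; apply: d2B; rewrite -ball_normE /= sub0r normrN.
by rewrite distrC.
Qed.

Lemma dense_cvg_seq {R : realType} {E : normedModType R} (S : set E) (u : E) :
  dense S -> exists2 u_ : nat -> E, forall n, S (u_ n) & u_ n @[n --> \oo] --> u.
Proof.
move=> dS.
have ex (n : nat) : exists v, S v /\ `|u - v| < n.+1%:R^-1.
  have n0 : 0 < n.+1%:R^-1 :> R by rewrite invr_gt0.
  have [||v] := dS (ball u n.+1%:R^-1).
  - by exists u; apply: ballxx.
  - exact: ball_open.
  - by rewrite -ball_normE => -[? ?]; exists v.
have [u_ Hu] := choice ex.
exists u_ => [n|]; first by case: (Hu n).
apply/cvgrPdist_le => e e0.
have := near_infty_natSinv_lt (PosNum e0); apply: filterS => n /= ne.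
by case: (Hu n) => _ /lt_trans/(_ ne)/ltW.
Qed.

(** * The operator norm as a supremum *)

Section OperatorNorm.
Context {R : realType} {H : completeNormedModType R}.

(** The bound [M] makes the supremum in [opnorm] genuine, since [sup] of an unbounded set is a
    default value; homogeneity rescales to the unit ball. *)
Lemma le_opnorm (f : H -> H) (M : R) :
    (forall a u, f (a *: u) = a *: f u) ->
    (forall u, `|u| <= 1 -> `|f u| <= M) ->
  forall u, `|f u| <= opnorm f * `|u|.
Proof.
move=> fZ fM u.
have [->|u0] := eqVneq u 0.
  by rewrite -(scale0r 0) fZ !scale0r normr0 mulr0.
rewrite -ler_pdivrMr ?normr_gt0//.
have -> : `|f u| / `|u| = `|f (`|u|^-1 *: u)|.
  by rewrite fZ normrZ normfV normr_id mulrC.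
have hub : has_ubound [set `|f u| | u in cball setT 1].
  by exists M => _ [v [_ ?] <-]; apply: fM.
apply: (ub_le_sup hub).
exists (`|u|^-1 *: u) => //; split => //.
by rewrite normrZ normfV normr_id mulVf// normr_eq0.
Qed.

Lemma compact_operator_bounded (T : {linear H -> H}) : compact_operator T ->
  exists M, forall u, `|u| <= 1 -> `|T u| <= M.
Proof.
rewrite /compact_operator precompactE => /compact_bounded/pinfty_ex_gt0[M _ TM].
by exists M => u u1; apply: TM; apply: subset_closure; exists u.
Qed.

End OperatorNorm.

(** * Projections and gradients defined by choice *)

Section Orthogonality.
Context {R : realType} {H : completeNormedModType R} (dot : {dot H for idfun}).
Hypothesis dot_norm : forall u, dot u u = `|u| ^+ 2.

Lemma orth_projE (W : set H) (v w : H) :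
  linear_subspace W -> W v -> orthc dot W w -> orth_proj dot W (v + w) = v.
Proof.
move=> [W0 Wlin] Wv Ww; rewrite /orth_proj; apply: xget_unique => [|y [Wy yo]].
  by split => //; rewrite [v + w]addrC addrK.
(* The difference of two candidates lies in [W] and is orthogonal to [W], hence to itself. *)
have Wvy : W (v - y) by rewrite addrC -scaleN1r; apply: Wlin.
have := yo _ Wvy; rewrite addrAC dotDl (Ww _ Wvy) addr0 dot_norm.
by move/eqP; rewrite sqrf_eq0 normr_eq0 subr_eq0 => /eqP.
Qed.

(** Any representing vector [g] shows that the choice in [grad] succeeds, and the value of a
    directional derivative is unique. *)
Lemma dot_grad (W : set H) (f : H -> R) (u g : H) :
    W g -> (forall v, W v -> is_derive u v f (dot g v)) ->
  forall v, W v -> dot (grad dot W f u) v = dot g v.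
Proof.
move=> Wg gP v Wv.
have [] : W (grad dot W f u) /\
    forall v, W v -> is_derive u v f (dot (grad dot W f u) v).
  by apply: (@xgetPex _ 0
    [set g | W g /\ forall v, W v -> is_derive u v f (dot g v)]); exists g.
by move=> _ /(_ v Wv) [_ <-]; have [_ <-] := gP v Wv.
Qed.

End Orthogonality.

(** * The derivative of [L] as a bounded linear functional on H *)

Section Derivative.
Context {R : realType} {H X : completeNormedModType R} {dot : {dot H for idfun}}
  {iota : {linear X -> H}} {V : set H} {L : H -> R} {A : X -> X}
  {B P Q : X -> {linear H -> H}}.
Hypothesis adm : strongly_admissible dot iota V L A B P Q.

Lemma cvg_near_V (x_ : nat -> H) x : V x -> x_ n @[n --> \oo] --> x ->
  \forall n \near \oo, V (x_ n).
Proof.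
move=> Vx; apply; apply: open_nbhs_nbhs; split => //; exact: sa_open adm.
Qed.

(* On the dense subspace [X] the derivative is represented by [A]; linearity
   then passes to the limit. *)
Lemma derive_L_linear x a u v : V x ->
  'D_(a *: u + v) L x = a * 'D_u L x + 'D_v L x.
Proof.
move=> Vx.
have [x_ xX xx] := dense_cvg_seq x (sa_dense adm).
have [u_ uX uu] := dense_cvg_seq u (sa_dense adm).
have [v_ vX vv] := dense_cvg_seq v (sa_dense adm).
have cD w_ w := @cvg_dir_derive _ _ _ _ _ (sa_open adm) (sa_F1 adm) x_ w_ x w Vx xx.
apply: (@cvg_unique _ _ ('D_(a *: u_ n + v_ n) L (x_ n) @[n --> \oo])) => //=.
  by apply: cD; apply: cvgD => //; apply: cvgZr.
apply: (@cvg_trans _ ((a * 'D_(u_ n) L (x_ n) + 'D_(v_ n) L (x_ n)) @[n --> \oo])).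
  apply: near_eq_cvg; have := cvg_near_V Vx xx; apply: filterS => n.
  case: (xX n) (uX n) (vX n) => y _ <- [s _ <-] [t _ <-] Vy.
  by rewrite -linearP !(sa_F2_grad adm)// linearP dotDr dotZr.
by apply: cvgD; [apply: cvgMl_tmp; apply: cD|apply: cD].
Qed.

(** Continuity at [(x, 0)] keeps the derivative below 1 on directions of norm less than some [d];
    rescaling [v] to norm [d / 2] gives the constant [2 / d]. *)
Lemma derive_L_bounded x : V x -> exists C, forall v, `|'D_v L x| <= C * `|v|.
Proof.
move=> Vx.
have := cont_dir_derive (sa_open adm) (sa_F1 adm) (v := 0) Vx.
move/cvgrPdist_lt => /(_ 1 ltr01) [[S T]] /= [xS T0] ST.
case/nbhs_ballP: T0 => d /= d0 dT.
have DZ a u : 'D_(a *: u) L x = a * 'D_u L x.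
  by rewrite -[a *: u]addr0 derive_L_linear// derive0 addr0.
exists (2 / d) => v; have [->|v0] := eqVneq v 0.
  by rewrite derive0 !normr0 mulr0.
have vn : 0 < `|v| by rewrite normr_gt0.
have := ST (x, (d / (2 * `|v|)) *: v); rewrite derive0 sub0r normrN /= DZ => h.
have dv : 0 < d / (2 * `|v|) by rewrite divr_gt0// mulr_gt0.
have : `|d / (2 * `|v|) * 'D_v L x| < 1.
  apply: h; split; first exact: nbhs_singleton xS.
  apply: dT; rewrite -ball_normE /= sub0r normrN normrZ gtr0_norm//.
  have -> : d / (2 * `|v|) * `|v| = d / 2 by field; rewrite gt_eqF.
  lra.
rewrite normrM gtr0_norm// => /ltW; rewrite -ler_pdivlMl//.
by rewrite invf_div mulr1 mulrAC.
Qed.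

Lemma derive_L_riesz x : V x ->
  exists g, forall v, is_derive x v L (dot g v).
Proof.
move=> Vx; have [C DC] := derive_L_bounded Vx.
have [g gP] := riesz_representation (sa_hilbert adm)
  (fun a u v => derive_L_linear a u v Vx) DC.
exists g => v; rewrite -gP; apply: derivableP.
by case: (sa_F1 adm) => + _; apply.
Qed.

Lemma L_continuous x : V x -> {for x, continuous L}.
Proof.
exact: cont_dir_differentiable_continuous (sa_open adm) (sa_F1 adm) x.
Qed.

End Derivative.

(** In use, [x] is [z + h z], [q] the norm of [Q 0] and [K] a bound for [omega]. The bounds depend
    on [p] only through its norm, so they pass to limits in [p]. *)
Definition reduced_bounds {R : realType} {H : completeNormedModType R}
    (L : H -> R) (a0 a1 q C2 K : R) (x m p : H) :=
  [/\ a1 * `|p| ^+ 2 - K * `|m| * `|p| <= 'D_p L (x + (m + p)),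
      'D_m L (x + (m + p)) <= K * `|m| * `|p| - a0 * `|m| ^+ 2,
      (a1 * `|p| ^+ 2 - 2 * K * `|m| * `|p| - q * `|m| ^+ 2) / 2
        <= L (x + (m + p)) - L x &
      L (x + (m + p)) - L x <=
        ((3 / 2 * C2 + q) * `|p| ^+ 2 + 2 * K * `|m| * `|p| - a0 * `|m| ^+ 2) / 2].

(** * Block estimates of the Hessian form *)

Section Estimates.
Context {R : realType} {H X : completeNormedModType R} {dot : {dot H for idfun}}
  {iota : {linear X -> H}} {V : set H} {L : H -> R} {A : X -> X}
  {B P Q : X -> {linear H -> H}} (adm : strongly_admissible dot iota V L A B P Q)
  {eta0 C1 C2 : R} (hP : form_bounds dot iota V P eta0 C1 C2)
  {Hp Hm : set H} (hHpm : spectral_splitting dot iota B Hp Hm)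
  {a0 : R} {h : H -> X} {d : R} (hh : reduction_map dot iota V A B h d)
  {omega : X -> R} {U : set H} {a1 : R}
  (hU : local_estimates dot iota V B Hp Hm omega a0 a1 U)
  {rho rho0 : R}
  (hrho0 : small_rho0 iota B Q Hp Hm eta0 C1 C2 a1 U omega h d rho rho0).

Let dot_norm := sa_hilbert adm.

Lemma dot_HmHp m p : Hm m -> Hp p -> dot p m = 0.
Proof. by move=> Hmm Hpp; apply: (ss_orthpm hHpm). Qed.

Lemma orthc_HmHp m p : Hm m -> Hp p -> orthc dot (opker (B 0)) (m + p).
Proof.
move=> Hmm Hpp z Hz.
by rewrite dotDl (ss_orthm hHpm Hmm Hz) (ss_orthp hHpm Hpp Hz) addr0.
Qed.

Lemma VX0 : V (iota 0).
Proof. by rewrite linear0; exact: sa_0 adm. Qed.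

Let q := opnorm (Q 0).

Lemma opnormQ0_ge0 : 0 <= q.
Proof.
have [M QM] := compact_operator_bounded (sa_D_compact adm VX0).
apply: ub_le_sup; first by exists M => _ [v [_ ?] <-]; apply: QM.
by exists 0; rewrite ?linear0 ?normr0//; split => //; rewrite normr0 ler01.
Qed.

(** Split [Q x] as [Q 0] plus a difference; compactness makes both operator norms finite. *)
Lemma Q_form_bound x u : V (iota x) -> opnorm (Q x \- Q 0) <= C1 / 2 ->
  `|dot (Q x u) u| <= (q + C1 / 2) * `|u| ^+ 2.
Proof.
move=> Vx QC.
have [M QM] := compact_operator_bounded (sa_D_compact adm VX0).
have [N QN] := compact_operator_bounded (sa_D_compact adm Vx).
have Q0u : `|Q 0 u| <= q * `|u|.
  by apply: (le_opnorm _ QM) => a v; rewrite linearZ.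
have QQu : `|Q x u - Q 0 u| <= C1 / 2 * `|u|.
  apply: le_trans (_ : opnorm (Q x \- Q 0) * `|u| <= _); last exact: ler_wpM2r.
  apply: (@le_opnorm _ _ (Q x \- Q 0) (N + M)) => [a v|v v1] /=.
    by rewrite [Q x _]linearZ_LR [Q 0 _]linearZ_LR scalerBr.
  by apply: le_trans (ler_normB _ _) _; rewrite lerD ?QN ?QM.
apply: le_trans (dot_CauchySchwarz dot_norm _ _) _.
rewrite expr2 mulrA ler_wpM2r// -[Q x u](subrK (Q 0 u)).
by apply: le_trans (ler_normD _ _) _; rewrite mulrDl addrC lerD.
Qed.

(** Expand in blocks; self-adjointness identifies the two mixed ones, which [omega] controls. One
    side of each diagonal block is a local estimate, the other comes from [P + Q]: on [p],
    [C1 <= C2] turns [C2 + q + C1 / 2] into [3 / 2 * C2 + q]; on [m], the term [C1 / 2] is absorbed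
    by the positivity of [P]. *)
Lemma hessian_bounds (K : R) x m p :
    U (iota x) -> `|iota x| < eta0 -> opnorm (Q x \- Q 0) <= C1 / 2 ->
    omega x <= K -> Hm m -> Hp p ->
  [/\ a1 * `|p| ^+ 2 - K * `|m| * `|p| <= dot (B x (m + p)) p,
      dot (B x (m + p)) m <= K * `|m| * `|p| - a0 * `|m| ^+ 2,
      a1 * `|p| ^+ 2 - 2 * K * `|m| * `|p| - q * `|m| ^+ 2
        <= dot (B x (m + p)) (m + p) &
      dot (B x (m + p)) (m + p) <=
        (3 / 2 * C2 + q) * `|p| ^+ 2 + 2 * K * `|m| * `|p| - a0 * `|m| ^+ 2].
Proof.
move=> Ux xeta QC xK Hmm Hpp.
have Vx := est_V hU Ux.
have [_ C10 C12 /(_ x _ Vx xeta) PC] := hP.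
have Bpp := est_pos hU Ux Hpp.
have Bmm := est_neg hU Ux Hmm.
have Bmp : dot (B x m) p = dot (B x p) m.
  by have [_ ->] := sa_F3_sa adm Vx; rewrite dotC.
have : `|dot (B x p) m| <= K * `|m| * `|p|.
  have Hm0 : set_sum Hm (opker (B 0)) m.
    by exists m => //; exists 0; rewrite ?addr0//; rewrite /opker /= linear0.
  apply: le_trans (est_mix hU Ux Hpp Hm0) _.
  by rewrite mulrAC -2!mulrA ler_wpM2r// mulr_ge0.
rewrite ler_norml => /andP[Bpm1 Bpm2].
have : dot (B x p) p <= (3 / 2 * C2 + q) * `|p| ^+ 2.
  rewrite (sa_D adm)// dotDl.
  have := Q_form_bound p Vx QC; rewrite ler_norml => /andP[_ ?].
  have /andP[_ ?] := PC p.
  have : C1 * `|p| ^+ 2 <= C2 * `|p| ^+ 2 by rewrite ler_wpM2r// ltW.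
  lra.
have : - q * `|m| ^+ 2 <= dot (B x m) m.
  rewrite (sa_D adm)// dotDl.
  have := Q_form_bound m Vx QC; rewrite ler_norml => /andP[? _].
  have /andP[? _] := PC m.
  have : 0 <= C1 * `|m| ^+ 2 by rewrite mulr_ge0// ltW.
  lra.
move=> Bmm2 Bpp2.
by split; rewrite [B x _]linearD dotDl ?dotDr ?dotDr ?Bmp; lra.
Qed.

(** * [A] and [L] along a segment starting on the graph of [h] *)

Section Line.
Variables (y w : X).
Let a := y + h (iota y).
Hypothesis y0 : cball (opker (B 0)) rho0 (iota y).
Hypothesis wV : forall t : R, 0 <= t <= 1 -> V (iota (a + t *: w)).

Lemma A_base_orth v : orthc dot (opker (B 0)) v -> dot (iota (A a)) v = 0.
Proof.
move=> v0.
have yd : cball (opker (B 0)) d (iota y).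
  by case: y0 => ? ?; split => //; apply: le_trans (s0_d hrho0).
have /= /eqP := rm_eq hh yd.
rewrite subr_eq0 -/a => /eqP ->; rewrite dotC; apply: v0.
(* Both outcomes of the choice lie in the kernel: a projection by definition, the default value 0
   trivially. *)
rewrite /orth_proj; case: xgetP => [_ _ []//|_].
by rewrite /opker /= linear0.
Qed.

Lemma is_derive_A_line (v : X) (t : R) : 0 <= t <= 1 ->
  is_derive t 1 (fun t : R => dot (iota (A (a + t *: w))) (iota v))
    (dot (B (a + t *: w) (iota w)) (iota v)).
Proof.
move=> t01; rewrite -(sa_F3_hess adm _ _ (wV t01)).
apply: (is_derive_line (T := fun x => dot (iota (A x)) (iota v))).
apply: (@is_derive_scalar_comp _ _ _ (fun x => dot (iota x) (iota v)) `|iota v|).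
- by move=> k r s; rewrite linearP dotDl dotZl.
- move=> r; apply: le_trans (dot_CauchySchwarz dot_norm _ _) _.
  by rewrite mulrC ler_wpM2l// (sa_norm adm).
- by apply: derivableP; case: (sa_F2_cdd adm) => + _; apply; apply: wV.
Qed.

(** The function [t] to [dot (iota (A (a + t *: w))) (iota v)] vanishes at 0, as [A a] lies in the
    kernel; its value at 1 is thus its derivative at an intermediate point. *)
Lemma derive_L_mean_value (v : X) : orthc dot (opker (B 0)) (iota v) ->
  exists2 t : R, 0 <= t <= 1 &
    'D_(iota v) L (iota (a + w)) = dot (B (a + t *: w) (iota w)) (iota v).
Proof.
move=> v0; have [t t01] := mean_value ler01 (@is_derive_A_line v).
rewrite scale1r scale0r addr0 (A_base_orth v0) subr0 mulr1 => tE.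
exists t => //; rewrite -tE (sa_F2_grad adm)//.
by have := @wV 1; rewrite scale1r; apply; rewrite ler01 lexx.
Qed.

Lemma is_derive_L_line (t : R) : 0 <= t <= 1 ->
  is_derive t 1 (fun t : R => L (iota a + t *: iota w))
    (dot (iota (A (a + t *: w))) (iota w)).
Proof.
move=> t01; apply: is_derive_line; rewrite -linearZ -linearD.
rewrite -(sa_F2_grad adm _ (wV t01)); apply: derivableP.
by case: (sa_F1 adm) => + _; apply; apply: wV.
Qed.

Lemma L_increment_ge (k : R) : orthc dot (opker (B 0)) (iota w) ->
    (forall t : R, 0 <= t <= 1 -> k <= dot (B (a + t *: w) (iota w)) (iota w)) ->
  k / 2 <= L (iota (a + w)) - L (iota a).
Proof.
move=> w0 kB; have := second_order_ge is_derive_L_line (is_derive_A_line w).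
rewrite !scale1r !scale0r !addr0 -linearD; apply => //.
by rewrite (A_base_orth w0).
Qed.

Lemma L_increment_le (k : R) : orthc dot (opker (B 0)) (iota w) ->
    (forall t : R, 0 <= t <= 1 -> dot (B (a + t *: w) (iota w)) (iota w) <= k) ->
  L (iota (a + w)) - L (iota a) <= k / 2.
Proof.
move=> w0 kB; have := second_order_le is_derive_L_line (is_derive_A_line w).
rewrite !scale1r !scale0r !addr0 -linearD; apply => //.
by rewrite (A_base_orth w0).
Qed.

End Line.

(** * Bounds on the whole box: first on X, then by density *)

Lemma box_scale (t : R) m p : 0 <= t <= 1 ->
    cball Hm rho0 m -> cball Hp rho0 p -> box Hp Hm rho0 rho0 (t *: (m + p)).
Proof.
move=> /andP[t0 t1].
have sc W v : linear_subspace W -> cball W rho0 v -> cball W rho0 (t *: v).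
  move=> [W0 Wlin] [Wv v1]; split; first by rewrite -[_ *: _]addr0; apply: Wlin.
  by apply: le_trans v1; rewrite normrZ ger0_norm// ler_piMl.
move=> mb pb; rewrite scalerDr; exists (t *: m); first exact: sc (ss_subm hHpm) mb.
by exists (t *: p) => //; exact: sc (ss_subp hHpm) pb.
Qed.

(** The kernel and H^- are contained in X, so with [p] in X the whole segment lies in X, and
    [hessian_bounds] applies at each of its points. *)
Lemma reduced_bounds_X (K : R) z m (p : X) :
    (forall u x, box Hp Hm rho0 rho0 u -> iota x = z + iota (h z) + u ->
       omega x <= K) ->
    cball (opker (B 0)) rho0 z -> cball Hm rho0 m -> cball Hp rho0 (iota p) ->
  reduced_bounds L a0 a1 q C2 K (z + iota (h z)) m (iota p).
Proof.
move=> oK zb mb pb.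
have [y _ yz] := ss_0X hHpm (proj1 zb); rewrite -{}yz in oK zb *.
have [n _ nm] := ss_mX hHpm (proj1 mb); rewrite -{}nm in mb *.
pose a := y + h (iota y); pose w := n + p.
have wE : iota w = iota n + iota p by rewrite linearD.
have aE t : iota (a + t *: w) = iota y + iota (h (iota y)) + t *: (iota n + iota p).
  by rewrite -wE -linearD -linearZ -linearD.
have wb t t01 := @box_scale t _ _ t01 mb pb.
have wdom (t : R) : 0 <= t <= 1 -> U (iota (a + t *: w)) /\ `|iota (a + t *: w)| < eta0.
  by move=> t01; rewrite aE; apply: (s0_dom hrho0) => //; apply: wb.
have wV (t : R) : 0 <= t <= 1 -> V (iota (a + t *: w)).
  by move=> /wdom[? _]; apply: (est_V hU).
have hB (t : R) : 0 <= t <= 1 -> _ := fun t01 =>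
  @hessian_bounds K (a + t *: w) (iota n) (iota p) (proj1 (wdom t t01))
    (proj2 (wdom t t01))
    (let: And3 q1 _ _ := s0_bounds hrho0 zb (wb t t01) (aE t) in q1)
    (oK _ _ (wb t t01) (aE t)) (proj1 mb) (proj1 pb).
have w0 := orthc_HmHp (proj1 mb) (proj1 pb).
have [H0m Hp0] : Hm 0 /\ Hp 0.
  by split; [case: (ss_subm hHpm)|case: (ss_subp hHpm)].
have n0 : orthc dot (opker (B 0)) (iota n).
  by have := orthc_HmHp (proj1 mb) Hp0; rewrite addr0.
have p0 : orthc dot (opker (B 0)) (iota p).
  by have := orthc_HmHp H0m (proj1 pb); rewrite add0r.
rewrite /reduced_bounds -linearD -wE -linearD.
split.
- by have [t /hB[+ _ _ _] ->] := derive_L_mean_value zb wV p0; rewrite -wE.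
- by have [t /hB[_ + _ _] ->] := derive_L_mean_value zb wV n0; rewrite -wE.
- apply: (L_increment_ge zb wV); rewrite wE// => t /hB[_ _ + _]; exact.
- apply: (L_increment_le zb wV); rewrite wE// => t /hB[_ _ _ +]; exact.
Qed.

(** Subtracting from [x] its components in the kernel and in H^-, which belong to X, leaves its H^+
    component; by Pythagoras this is no farther from [p] than [x] is. *)
Lemma HpX_approx p x : Hp p ->
  exists2 y : X, Hp (iota y) & `|p - iota y| <= `|p - iota x|.
Proof.
move=> Hpp.
have : set_sum (set_sum (opker (B 0)) Hp) Hm (iota x) by rewrite (ss_sum hHpm).
move=> [_ [u0 Hu0 [up Hup <-]] [um Hum xE]].
have [y0 _ y0E] := ss_0X hHpm Hu0; have [ym _ ymE] := ss_mX hHpm Hum.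
have upE : iota (x - y0 - ym) = up.
  by rewrite !linearB -xE y0E ymE addrAC addrK addrAC subrr add0r.
exists (x - y0 - ym); rewrite upE//.
have Hpd : Hp (p - up).
  by rewrite addrC -scaleN1r; apply: (proj2 (ss_subp hHpm)).
rewrite -(ler_pXn2r (_ : (0 < 2)%N)) ?nnegrE//.
have -> : p - iota x = (p - up) + - (u0 + um).
  by rewrite -xE [u0 + up]addrC -addrA opprD addrA.
rewrite (sqr_normD dot_norm (p - up)) -[- (u0 + um)]scaleN1r dotZr dotDr.
rewrite (ss_orthp hHpm Hpd Hu0) (dot_HmHp Hum Hpd) addr0 !mulr0 addr0.
by rewrite lerDl.
Qed.

Lemma cball_HpX_approx p x : cball Hp rho0 p ->
  exists2 y : X, cball Hp rho0 (iota y) & `|p - iota y| <= 2 * `|p - iota x|.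
Proof.
move=> [Hpp pr]; have [y Hpy py] := HpX_approx x Hpp.
have [yr|yr] := leP `|iota y| rho0.
  exists y => //; have := normr_ge0 (p - iota x); lra.
have r0 : 0 <= rho0 by apply: le_trans pr.
have y0 : 0 < `|iota y| by apply: le_lt_trans yr.
(* An approximant outside the ball is pulled back radially. It moves by [|y| - rho0], at most its
   distance to [p], whence the factor 2. *)
pose k := rho0 / `|iota y|.
have k0 : 0 <= k by rewrite divr_ge0.
have kE : k * `|iota y| = rho0 by rewrite divfK// gt_eqF.
have kyE : iota (k *: y) = k *: iota y by rewrite linearZ.
exists (k *: y); rewrite kyE.
  split; last by rewrite normrZ ger0_norm// kE.
  by rewrite -[_ *: _]addr0; apply: (proj2 (ss_subp hHpm)) => //;
    exact: (proj1 (ss_subp hHpm)).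
have k1 : k <= 1 by rewrite ler_pdivrMr// mul1r ltW.
have yk : `|iota y - k *: iota y| = `|iota y| - rho0.
  rewrite -{1}[iota y]scale1r -scalerBl normrZ ger0_norm ?subr_ge0//.
  by rewrite mulrBl mul1r kE.
have : `|iota y| <= `|p| + `|p - iota y|.
  by rewrite -[X in `|X| <= _](subKr p) (le_trans (ler_normB _ _)).
have := ler_distD (iota y) p (k *: iota y); rewrite yk; lra.
Qed.

Lemma HpX_dense p : cball Hp rho0 p -> exists2 p_ : nat -> X,
  forall n, cball Hp rho0 (iota (p_ n)) & iota (p_ n) @[n --> \oo] --> p.
Proof.
move=> pb; have [x_ xX xp] := dense_cvg_seq p (sa_dense adm).
have ex n : exists y, cball Hp rho0 (iota y) /\ `|p - iota y| <= 2 * `|p - x_ n|.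
  by have [x _ <-] := xX n; have [y] := cball_HpX_approx x pb; exists y.
have [p_ pP] := choice ex; exists p_ => [n|]; first by case: (pP n).
apply/cvgrPdist_le => e e0.
have e2 : 0 < e / 2 by rewrite divr_gt0.
move/cvgrPdist_le : xp => /(_ _ e2); apply: filterS => n xe.
by have [_] := pP n; move: xe; lra.
Qed.

Lemma reduced_bounds_box (K : R) z m p :
    (forall u x, box Hp Hm rho0 rho0 u -> iota x = z + iota (h z) + u ->
       omega x <= K) ->
    cball (opker (B 0)) rho0 z -> cball Hm rho0 m -> cball Hp rho0 p ->
  reduced_bounds L a0 a1 q C2 K (z + iota (h z)) m p.
Proof.
move=> oK zb mb pb; have [p_ pX pp] := HpX_dense pb.
have bX n := reduced_bounds_X oK zb mb (pX n).
set x := z + iota (h z) in bX *.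
have Vx : V (x + (m + p)).
  have t01 : 0 <= (1 : R) <= 1 by rewrite ler01 lexx.
  have := box_scale t01 mb pb; rewrite scale1r => /(s0_dom hrho0 zb)[? _].
  exact: (est_V hU).
have np : `|iota (p_ n)| @[n --> \oo] --> `|p| by apply: cvg_norm.
have np2 : `|iota (p_ n)| ^+ 2 @[n --> \oo] --> `|p| ^+ 2.
  by under eq_fun do rewrite expr2; rewrite expr2; apply: cvgM.
have xp : x + (m + iota (p_ n)) @[n --> \oo] --> x + (m + p).
  by do 2 (apply: cvgD; first exact: cvg_cst).
have Lp : L (x + (m + iota (p_ n))) - L x @[n --> \oo] --> L (x + (m + p)) - L x.
  apply: cvgB; last exact: cvg_cst.
  by apply: continuous_cvg xp; exact: L_continuous adm _ Vx.
have DL v_ v := cvg_dir_derive (sa_open adm) (sa_F1 adm) Vx xp (v_ := v_) (v := v).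
(* All four bounds are quadratic polynomials in the norm of [p], so this one limit serves them
   all. *)
have lin (b c e : R) : b * `|iota (p_ n)| ^+ 2 + c * `|iota (p_ n)| + e
    @[n --> \oo] --> b * `|p| ^+ 2 + c * `|p| + e.
  apply: cvgD; last exact: cvg_cst.
  by apply: cvgD; apply: cvgMl_tmp.
split.
- have := lin a1 (- (K * `|m|)) 0; rewrite addr0 mulNr => l1.
  apply: ler_cvg_to l1 (DL _ _ pp) _; apply: nearW => n /=.
  by have [+ _ _ _] := bX n; rewrite addr0 mulNr.
- have := lin 0 (K * `|m|) (- (a0 * `|m| ^+ 2)); rewrite mul0r add0r => l1.
  apply: ler_cvg_to (DL _ _ (cvg_cst _)) l1 _; apply: nearW => n /=.
  by have [_ + _ _] := bX n; rewrite mul0r add0r.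
- rewrite -(ler_pM2r (ltr0n _ 2)) divfK ?pnatr_eq0//.
  have := lin a1 (- (2 * K * `|m|)) (- (q * `|m| ^+ 2)); rewrite mulNr => l1.
  apply: ler_cvg_to l1 (cvgMr_tmp Lp (b := 2)) _; apply: nearW => n /=.
  by have [_ _ + _] := bX n; lra.
- rewrite -(ler_pM2r (ltr0n _ 2)) divfK ?pnatr_eq0//.
  have l1 := lin (3 / 2 * C2 + q) (2 * K * `|m|) (- (a0 * `|m| ^+ 2)).
  apply: ler_cvg_to (cvgMr_tmp Lp (b := 2)) l1 _; apply: nearW => n /=.
  by have [_ _ _ +] := bX n; lra.
Qed.

End Estimates.

(** * Gradients at points of H *)

Section Gradients.
Context {R : realType} {H X : completeNormedModType R} {dot : {dot H for idfun}}
  {iota : {linear X -> H}} {V : set H} {L : H -> R} {A : X -> X}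
  {B P Q : X -> {linear H -> H}} (adm : strongly_admissible dot iota V L A B P Q)
  {Hp Hm : set H} (hHpm : spectral_splitting dot iota B Hp Hm).

Lemma dot_nablaL u v : V u -> dot (grad dot setT L u) v = 'D_v L u.
Proof.
move=> Vu; have [g gP] := derive_L_riesz adm Vu.
by have [_ ->] := gP v; apply: dot_grad.
Qed.

(** Dropping the kernel component of the Riesz vector of the derivative of [L] gives a vector
    orthogonal to the kernel that represents the same functional there. *)
Lemma dot_nabla2F (h : H -> X) z u v : V (z + iota (h z) + u) ->
    orthc dot (opker (B 0)) v ->
  dot (grad dot (orthc dot (opker (B 0))) (reducedF iota L h z) u) v =
    'D_v L (z + iota (h z) + u).
Proof.
move=> Vu v0; have [g gP] := derive_L_riesz adm Vu.
have : set_sum (set_sum (opker (B 0)) Hp) Hm g by rewrite (ss_sum hHpm).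
move=> [_ [g0 Hg0 [gp Hgp <-]] [gm Hgm gE]].
have dotg w : orthc dot (opker (B 0)) w -> dot g w = dot (gm + gp) w.
  by move=> w0; rewrite -gE -addrA (dotDl dot g0) (dotC dot g0) (w0 _ Hg0) add0r addrC.
have [_ ->] := gP v; rewrite dotg//; apply: dot_grad => //.
- exact: orthc_HmHp hHpm _ _ Hgm Hgp.
- by move=> w w0; rewrite -dotg//; apply: is_derive_translate.
Qed.

End Gradients.

(** * Scalar inequalities behind the choice of a1' and r *)

Section Arithmetic.
Context {R : realType}.

(** Here [Ap] is a1' and [mu] the norm of [m]. The hypotheses give [K <= 3 / 8 * a1 ^+ 2] and
    [(K * r) ^+ 2 <= K * s ^+ 2]; since 3/8 is less than (7/8)^2, [K * r <= 7 / 8 * a1 * s], which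
    leaves [a1 / 8]. *)
Lemma positive_estimate (a1 Ap K r s mu : R) :
    0 < a1 -> 1 <= 3 * a1 * Ap -> 0 <= K -> K * (8 * Ap) <= a1 ->
    0 < s -> 0 < r -> a1 * r ^+ 2 = 8 * Ap * s ^+ 2 -> mu <= r ->
  a1 / 8 * s ^+ 2 <= a1 * s ^+ 2 - K * mu * s.
Proof.
move=> a1_gt0 a1Ap K_ge0 KAp s_gt0 r_gt0 rs mur.
have K3 : K <= 3 / 8 * a1 ^+ 2.
  have : K * 1 <= K * (3 * a1 * Ap) by rewrite ler_wpM2l.
  have : a1 * (K * (8 * Ap)) <= a1 * a1 by rewrite ler_wpM2l// ltW.
  lra.
have Kr : (K * r) ^+ 2 <= K * s ^+ 2.
  rewrite -(ler_pM2l a1_gt0).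
  have -> : a1 * (K * r) ^+ 2 = K * s ^+ 2 * (K * (8 * Ap)).
    by rewrite exprMn mulrCA rs; ring.
  by rewrite mulrC ler_wpM2r// mulr_ge0// sqr_ge0.
have : K * r <= 7 / 8 * a1 * s.
  have as_ge0 : 0 <= 7 / 8 * a1 * s by rewrite !mulr_ge0// ltW.
  rewrite -(ler_pXn2r (_ : (0 < 2)%N)) ?nnegrE ?(mulr_ge0 K_ge0 (ltW r_gt0))//.
  apply: (le_trans Kr).
  have : K * s ^+ 2 <= 3 / 8 * a1 ^+ 2 * s ^+ 2 by rewrite ler_wpM2r// sqr_ge0.
  have : 0 <= a1 ^+ 2 * s ^+ 2 by rewrite mulr_ge0// sqr_ge0.
  rewrite !exprMn; lra.
move=> Krs; have : K * mu * s <= 7 / 8 * a1 * s * s.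
  by rewrite ler_wpM2r ?(ltW s_gt0)//; apply: le_trans Krs; rewrite ler_wpM2l.
lra.
Qed.

(** By Young's inequality the lower bound on the increment can reach the level [- (Ap * s ^+ 2)]
    only if [s <= mu]. Then [pi <= mu], and with [K <= a1 / 4] the term [a0 * mu ^+ 2] dominates. *)
Lemma negative_estimate (a0 a1 q Ap K s mu pi : R) :
    0 < a1 -> a1 <= a0 -> 0 <= q -> q / 2 + 1 / 2 <= Ap ->
    0 <= K -> K ^+ 2 <= a1 / 2 -> K * (8 * Ap) <= a1 ->
    0 < s -> 0 <= mu -> 0 <= pi -> pi <= s ->
    (a1 * pi ^+ 2 - 2 * K * mu * pi - q * mu ^+ 2) / 2 <= - (Ap * s ^+ 2) ->
  K * mu * pi - a0 * mu ^+ 2 <= - (a1 / 8 * s ^+ 2).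
Proof.
move=> a1_gt0 a10 q_ge0 Ap_ge K_ge0 K2 KAp s_gt0 mu_ge0 pi_ge0 pis F.
have K_le : K <= a1 / 4.
  have Ap4 : 4 <= 8 * Ap by lra.
  by have := ler_wpM2l K_ge0 Ap4; lra.
have AMGM : 2 * K * mu * pi <= a1 * pi ^+ 2 + mu ^+ 2 / 2.
  rewrite -(ler_pM2l a1_gt0); have := sqr_ge0 (a1 * pi - K * mu).
  have : K ^+ 2 * mu ^+ 2 <= a1 / 2 * mu ^+ 2 by rewrite ler_wpM2r// sqr_ge0.
  lra.
have smu : s ^+ 2 <= mu ^+ 2.
  have q0 : 0 < q + 1 / 2 by lra.
  rewrite -(ler_pM2l q0).
  have qA : q + 1 / 2 <= 2 * Ap by lra.
  by have := ler_wpM2r (sqr_ge0 s) qA; lra.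
have pimu : pi <= mu.
  apply: (le_trans pis).
  by rewrite -(ler_pXn2r (_ : (0 < 2)%N)) ?nnegrE ?(ltW s_gt0).
have : K * mu * pi <= a1 / 4 * mu * mu.
  by rewrite ler_pM ?mulr_ge0// ler_wpM2r.
have : a1 * mu ^+ 2 <= a0 * mu ^+ 2 by rewrite ler_wpM2r// sqr_ge0.
have : a1 * s ^+ 2 <= a1 * mu ^+ 2 by rewrite ler_wpM2l// ltW.
have : 0 <= a1 * s ^+ 2 by rewrite mulr_ge0 ?sqr_ge0// ltW.
lra.
Qed.

(** Young's inequality costs half of [a1 * r ^+ 2 = 8 * Ap * s ^+ 2]; the remaining
    [4 * Ap * s ^+ 2] outweighs the [pi] terms, at most [2 * Ap * s ^+ 2], by exactly what is
    claimed after halving. *)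
Lemma level_estimate (a0 a1 q C2 Ap K r s pi : R) :
    0 < a1 -> a1 <= a0 -> 0 <= q -> 0 <= C2 -> C2 + q / 2 + 1 / 2 <= Ap ->
    K ^+ 2 <= a1 / 2 -> a1 * r ^+ 2 = 8 * Ap * s ^+ 2 ->
    0 <= pi -> pi <= s ->
  ((3 / 2 * C2 + q) * pi ^+ 2 + 2 * K * r * pi - a0 * r ^+ 2) / 2
    <= - (Ap * s ^+ 2).
Proof.
move=> a1_gt0 a10 q_ge0 C2_ge0 Ap_ge K2 rs pi_ge0 pis.
have AMGM : 2 * K * r * pi <= a1 * r ^+ 2 / 2 + pi ^+ 2.
  rewrite -(ler_pM2l a1_gt0); have := sqr_ge0 (a1 * r - 2 * K * pi).
  have : K ^+ 2 * pi ^+ 2 <= a1 / 2 * pi ^+ 2 by rewrite ler_wpM2r// sqr_ge0.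
  lra.
have pis2 : pi ^+ 2 <= s ^+ 2.
  by rewrite ler_pXn2r// nnegrE; apply: le_trans pis.
have : (3 / 2 * C2 + q + 1) * pi ^+ 2 <= 2 * Ap * s ^+ 2.
  by apply: ler_pM => //; [lra | exact: sqr_ge0 | lra].
have : a1 * r ^+ 2 <= a0 * r ^+ 2 by rewrite ler_wpM2r// sqr_ge0.
lra.
Qed.

End Arithmetic.

(** * Choice of the constants and proof of the assertions *)

Theorem proposition7p1 (R : realType) (H X : completeNormedModType R)
    (dot : {dot H for idfun}) (iota : {linear X -> H}) (V : set H)
    (L : H -> R) (A : X -> X) (B P Q : X -> {linear H -> H})
    (adm : strongly_admissible dot iota V L A B P Q)
    (A_diff : forall x, V (iota x) -> differentiable A x)
    (eta0 C1 C2 : R) (hP : form_bounds dot iota V P eta0 C1 C2)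
    (Hp Hm : set H) (hHpm : spectral_splitting dot iota B Hp Hm)
    (a0 : R) (ha0 : spectral_gap B a0)
    (h : H -> X) (d : R) (hh : reduction_map dot iota V A B h d)
    (omega : X -> R) (homega : modulus dot iota V B Hm omega)
    (U : set H) (a1 : R)
    (hU : local_estimates dot iota V B Hp Hm omega a0 a1 U)
    (rho : R) (hrho : small_rho B Hp Hm eta0 U rho)
    (rho0 : R)
    (hrho0 : small_rho0 iota B Q Hp Hm eta0 C1 C2 a1 U omega h d rho rho0)
    (s r : R) (hs : 0 < s <= rho0) (hr : 0 < r <= rho0)
    (hrs : r = s * Num.sqrt (8 * a1_prime Q C2 a1 / a1))
    (hbox : box Hp Hm r s `<=` box Hp Hm rho0 rho0) :
  let H0 := opker (B 0) in
  let F := reducedF iota L h in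
  let nabla2F z u := grad dot (orthc dot H0) (F z) u in
  let nablaL u := grad dot setT L u in
  let Pp := orth_proj dot Hp in
  let Pm := orth_proj dot Hm in
  let eps := a1_prime Q C2 a1 * s ^+ 2 in
  let hbar := a1 / 8 * s ^+ 2 in
  [/\ 0 < eps,
      0 < hbar,
      forall z u, cball H0 rho0 z -> box Hp Hm r s u ->
        [/\ `|Pp u| = s -> hbar <= dot (nabla2F z u) (Pp u),
            F z u = - eps -> dot (nabla2F z u) (Pm u) <= - hbar &
            `|Pm u| = r -> F z u <= - eps],
      forall u, box Hp Hm r s u ->
        `|Pp u| = s -> hbar <= dot (nablaL u) (Pp u) &
      (* the last two assertions presuppose the normalization of L at 0 *)
      L 0 = 0 -> forall u, box Hp Hm r s u ->
        (L u = - eps -> dot (nablaL u) (Pm u) <= - hbar) /\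
        (`|Pm u| = r -> L u <= - eps)].
Proof.
move=> H0 F nabla2F nablaL Pp Pm eps hbar.
have dot_norm := sa_hilbert adm.
have [a1_gt0 a10] : 0 < a1 /\ a1 <= a0 by apply/andP; exact: est_a1 hU.
have q0 : 0 <= opnorm (Q 0) := opnormQ0_ge0 adm.
have C2_ge0 : 0 <= C2.
  by have [_ C10 C12 _] := hP; rewrite ltW// (lt_trans C10).
set Ap := a1_prime Q C2 a1 in hrs eps *.
(* The first summand of a1' serves the lower and level estimates; the second, [(3 * a1)^-1], yields
   [a1Ap] for the positive one. *)
have Ap_ge : C2 + opnorm (Q 0) / 2 + 1 / 2 <= Ap.
  have : 0 <= (3 * a1)^-1 by rewrite invr_ge0 mulr_ge0// ltW.
  by rewrite /Ap /a1_prime; lra.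
have Ap_ge' : opnorm (Q 0) / 2 + 1 / 2 <= Ap by lra.
have Ap_gt0 : 0 < Ap by lra.
have a1Ap : 1 <= 3 * a1 * Ap.
  rewrite -ler_pdivrMl ?mulr_gt0// mulr1 /Ap /a1_prime lerDr.
  by rewrite divr_ge0 ?addr_ge0 ?mulr_ge0.
have /andP[s_gt0 s_le] := hs; have /andP[r_gt0 r_le] := hr.
have rs : a1 * r ^+ 2 = 8 * Ap * s ^+ 2.
  rewrite hrs exprMn sqr_sqrtr; first by field; rewrite gt_eqF.
  by rewrite divr_ge0 ?mulr_ge0 ?ltW.
have rho0_gt0 : 0 < rho0 by case/andP: (s0_pos hrho0).
(* The minimum of the two bounds on [omega] gives one constant satisfying both smallness
   conditions. *)
pose K := Num.min (Num.sqrt (a1 / 2)) (a1 / (8 * Ap)).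
have K_ge0 : 0 <= K.
  by rewrite le_min sqrtr_ge0 divr_ge0 ?mulr_ge0 ?ltW.
have K2 : K ^+ 2 <= a1 / 2.
  have a12 : 0 <= a1 / 2 by lra.
  by rewrite -[leRHS](sqr_sqrtr a12) ler_pXn2r ?nnegrE ?sqrtr_ge0// ge_min lexx.
have KAp : K * (8 * Ap) <= a1.
  by rewrite -ler_pdivlMr ?mulr_gt0// ge_min lexx orbT.
have omK z : cball H0 rho0 z -> forall u x, box Hp Hm rho0 rho0 u ->
    iota x = z + iota (h z) + u -> omega x <= K.
  move=> zb u x ub xE; have [_ w1 w2] := s0_bounds hrho0 zb ub xE.
  by rewrite le_min w2 (ltW w1).
have boxE z u : cball H0 rho0 z -> box Hp Hm r s u ->
  exists m p, [/\ [/\ `|m| <= r, `|p| <= s, Pm u = m & Pp u = p],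
    orthc dot H0 m, orthc dot H0 p, V (z + iota (h z) + u) &
    u = m + p /\ reduced_bounds L a0 a1 (opnorm (Q 0)) C2 K (z + iota (h z)) m p].
  move=> zb ub; have Vu := est_V hU (proj1 (s0_dom hrho0 zb (hbox _ ub))).
  case: ub Vu => m [Hmm mr] [p [Hpp ps] <-] Vu; exists m, p.
  have [Hp0 _] := ss_subp hHpm; have [Hm0 _] := ss_subm hHpm.
  split=> //.
  - split=> //; first by apply: (orth_projE dot_norm (ss_subm hHpm)) => // w Hw;
      exact: ss_orthpm hHpm _ Hpp _ Hw.
    rewrite addrC; apply: (orth_projE dot_norm (ss_subp hHpm)) => // w Hw.
    by rewrite dotC; exact: ss_orthpm hHpm _ Hw _ Hmm.
  - exact: ss_orthm hHpm _ Hmm.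
  - exact: ss_orthp hHpm _ Hpp.
  - split=> //; apply: (reduced_bounds_box adm hP hHpm hh hU hrho0 (omK z zb)) => //.
      by split=> //; apply: le_trans r_le.
    by split=> //; apply: le_trans s_le.
have z0b : cball H0 rho0 0 by split; rewrite /H0 /opker /= ?linear0// normr0 ltW.
(* For [z = 0] the base point is the origin, so the general bounds specialize to [L] itself. *)
have x0E : 0 + iota (h 0) = 0 by rewrite (rm_0 hh) linear0 addr0.
split.
- by rewrite mulr_gt0// exprn_gt0.
- by rewrite mulr_gt0 ?divr_gt0// exprn_gt0.
- move=> z u zb ub.
  have [m [p [[mr ps -> ->] m0 p0 Vu [uE [b1 b2 b3 b4]]]]] := boxE z u zb ub.
  rewrite /nabla2F !(dot_nabla2F adm hHpm)//.
  rewrite uE; split=> [pE|FE|mE].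
  + apply: le_trans b1; rewrite pE.
    exact: positive_estimate a1_gt0 a1Ap K_ge0 KAp s_gt0 r_gt0 rs mr.
  + apply: le_trans b2 _; apply: (negative_estimate a1_gt0 a10 q0 Ap_ge' K_ge0 K2 KAp s_gt0) => //.
    by apply: le_trans b3 _; move: FE; rewrite /F /reducedF => ->.
  + apply: le_trans b4 _; rewrite mE; exact: level_estimate a1_gt0 a10 q0 C2_ge0 Ap_ge K2 rs _ ps.
- move=> u ub pE.
  have [m [p [[mr ps _ pE'] m0 p0 Vu [uE [b1 _ _ _]]]]] := boxE 0 u z0b ub.
  rewrite x0E add0r in Vu; rewrite x0E add0r -uE in b1.
  rewrite pE' in pE *; rewrite /nablaL (dot_nablaL adm)//.
  apply: le_trans b1; rewrite pE; exact: positive_estimate a1_gt0 a1Ap K_ge0 KAp s_gt0 r_gt0 rs mr.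
- move=> L0 u ub.
  have [m [p [[mr ps -> _] m0 p0 Vu [uE]]]] := boxE 0 u z0b ub.
  rewrite x0E add0r in Vu; rewrite /reduced_bounds x0E !add0r -uE L0 subr0.
  move=> [_ b2 b3 b4]; rewrite /nablaL (dot_nablaL adm)//; split=> [LE|mE].
  + apply: le_trans b2 _; apply: (negative_estimate a1_gt0 a10 q0 Ap_ge' K_ge0 K2 KAp s_gt0) => //.
    by apply: le_trans b3 _; rewrite LE.
  + apply: le_trans b4 _; rewrite mE; exact: level_estimate a1_gt0 a10 q0 C2_ge0 Ap_ge K2 rs _ ps.
Qed.
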